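(* Let $m\ge 1$ and $r\ge 1$ be integers, let $x_1,\dots,x_m\in\mathbb{R}^r$ be known covariate vectors such that the $m\times r$ matrix $X=(x_1,\dots,x_m)^T$ has full column rank $r$, and let $D_1,\dots,D_m>0$ be known constants. Consider the hierarchical model $$y_i=\theta_i+e_i,\qquad \theta_i=x_i^T\beta+(1-\delta_i)v_{1i}+\delta_i v_{2i},\qquad i=1,\dots,m,$$ where, given the parameters $\beta\in\mathbb{R}^r$, $A_1,A_2>0$ and $p\in(0,1)$, the random variables $e_i,\delta_i,v_{1i},v_{2i}$ ($i=1,\dots,m$) are mutually independent with $e_i\sim N(0,D_i)$, $v_{1i}\sim N(0,A_1)$, $v_{2i}\sim N(0,A_2)$, and $\delta_i\in\{0,1\}$ with $P(\delta_i=1\mid p)=1-p$. Place on $(\beta,A_1,A_2,p)$ the (possibly improper) prior $$\pi(\beta,A_1,A_2,p)\propto A_1^{-\alpha_1}A_2^{-\alpha_2}\,I(0<A_1<A_2<\infty),\qquad \beta\in\mathbb{R}^r,\ p\in(0,1),$$ i.e. a uniform prior on $\beta\in\mathbb{R}^r$ and on $p\in(0,1)$, where $\alpha_1<1<\alpha_2$ are constants. If (a) $m>r+2(2-\alpha_1-\alpha_2)$ and (b) $2-\alpha_1-\alpha_2>0$, then for every observed data vector $y=(y_1,\dots,y_m)\in\mathbb{R}^m$ the resulting joint posterior distribution of $(\theta_1,\dots,\theta_m,\delta_1,\dots,\delta_m,\beta,A_1,A_2,p)$ given $y$ is proper (the unnormalized posterior has finite, positive total integral).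
   Context: The model is a two-component normal mixture extension of the Fay–Herriot small area model: $y_i$ is a direct survey estimator for small area $i$, $\theta_i$ the small area mean, $D_i$ the known sampling variance. The restriction $A_1<A_2$ in the prior is imposed for identifiability. The condition $\alpha_1<1<\alpha_2$ makes the prior on $(A_1,A_2)$ ''partially proper'' (conditional prior of $A_2$ given $A_1$ and of $A_1$ given $A_2$ proper). *)

(* Defs.v *)
From HB Require Import structures.
From mathcomp Require Import all_boot all_order all_algebra.
From mathcomp Require Import all_classical all_reals all_analysis.
Set Implicit Arguments. Unset Strict Implicit. Unset Printing Implicit Defensive.
Import Order.TTheory GRing.Theory Num.Theory.
Local Open Scope ring_scope.
Local Open Scope classical_set_scope.

(* Iterated Lebesgue integral over R^n of a nonnegative extended-real
   function of a vector v : nat -> R (only v 0, ..., v (n-1) matter).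
   iint n F = \int dt_0 ... \int dt_{n-1} F (t_0, ..., t_{n-1}). *)
Fixpoint iint {R : realType} (n : nat) (F : (nat -> R) -> \bar R) : \bar R :=
  match n with
  | 0 => F (fun _ => 0)
  | n'.+1 =>
      (\int[@lebesgue_measure R]_(t in [set: R])
         iint n' (fun v => F (fun k => if k is k'.+1 then v k' else t)))%E
  end.

(* Normal density with mean mu and VARIANCE V (library normal_pdf takes a
   standard deviation). *)
Definition npdf {R : realType} (mu V x : R) : R :=
  normal_pdf mu (Num.sqrt V) x.

(* Unnormalized joint posterior density of
   (theta, delta, beta, A1, A2, p) given y, for the two-component normal
   mixture Fay-Herriot model with prior
   A1^-alpha1 A2^-alpha2 I(0<A1<A2), beta flat on R^r, p uniform on (0,1).
   Here theta and beta are given as column vectors, delta as a finite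
   function 'I_m -> bool (true means delta_i = 1). *)
Definition post_density {R : realType} (m r : nat) (X : 'M[R]_(m, r))
  (D y : 'I_m -> R) (alpha1 alpha2 : R)
  (theta : 'cV[R]_m) (delta : {ffun 'I_m -> bool}) (beta : 'cV[R]_r)
  (A1 A2 p : R) : \bar R :=
  if (0 < A1) && (A1 < A2) && (0 < p) && (p < 1) then
    ((\prod_(i < m)
        (npdf (theta i 0) (D i) (y i)
         * npdf ((X *m beta) i 0) (if delta i then A2 else A1) (theta i 0)
         * (if delta i then 1 - p else p)))
     * powR A1 (- alpha1) * powR A2 (- alpha2))%:E
  else 0%E.

(* Total mass of the unnormalized posterior: sum over delta in {0,1}^m,
   Lebesgue integral over theta in R^m, beta in R^r, A1, A2, p in R
   (the density vanishes outside 0<A1<A2, 0<p<1). *)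
Definition posterior_mass {R : realType} (m r : nat) (X : 'M[R]_(m, r))
  (D y : 'I_m -> R) (alpha1 alpha2 : R) : \bar R :=
  (\sum_(delta : {ffun 'I_m -> bool})
     iint m (fun th =>
     iint r (fun b =>
     iint 3 (fun a =>
       post_density X D y alpha1 alpha2
         (\col_(i < m) th i) delta (\col_(j < r) b j) (a 0%N) (a 1%N) (a 2%N)))))%E.

(* Main.v *)
Require Import Defs.
From HB Require Import structures.
From mathcomp Require Import all_boot all_order all_algebra.
From mathcomp Require Import all_classical all_reals all_analysis.
From mathcomp Require Import measurable_realfun ring lra.
Set Implicit Arguments. Unset Strict Implicit. Unset Printing Implicit Defensive.
Import Order.TTheory GRing.Theory Num.Theory.
Import numFieldNormedType.Exports.
Local Open Scope ring_scope.
Local Open Scope classical_set_scope.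

(** Fix [delta] and write [V i] for the variance [A1] or [A2] selected by
    [delta i]. By Tonelli, integrate [theta] first: this replaces the two normal
    densities of area [i] by a probability density [f i], evaluated at
    [x_i^T beta], which is bounded by the peak of either factor, hence by
    [c := min ((2 pi A1)^(-1/2), K)] with [K] depending only on [D], because
    [A1 <= V i]. Since [X] has full column rank, [r] of the linear forms
    [x_i^T beta] can be used as coordinates; bounding the remaining [m - r]
    factors by [c], the [beta]-integral is at most [C * c ^ (m - r)], with [C]
    depending only on [X]. Integrating [A2^(-alpha2)] over [A2 > A1] leaves, up to
    a constant, the integral of [A1^(s - 1) * c ^ (m - r)] with
    [s := 2 - alpha1 - alpha2], which converges at [0] because [s > 0] and at
    infinity because [s < (m - r) / 2]. *)

(** * Integrals of nonnegative functions *)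

Section nonneg_integral.
Local Open Scope ereal_scope.
Context (d : measure_display) (T : measurableType d) (R : realType).
Variable mu : {measure set T -> \bar R}.

(** Such an integral is the supremum over the simple functions below the integrand, so comparison is
    available for arbitrary functions, measurable or not. *)
Lemma ge0_le_integralT (f g : T -> \bar R) :
  (forall x, 0 <= f x) -> (forall x, f x <= g x) ->
  \int[mu]_x f x <= \int[mu]_x g x.
Proof.
move=> f0 fg; have g0 x : 0 <= g x by exact: le_trans (f0 x) (fg x).
rewrite !ge0_integralTE//; apply: ereal_sup_le => _ [h /= hf <-].
by exists h => // x; exact: le_trans (hf x) (fg x).
Qed.

(** Were the integral zero, [f] would vanish almost everywhere and [E] would lie in a null set. *)
Lemma integral_gt0 (f : T -> \bar R) (E : set T) :
  measurable_fun setT f -> (forall x, 0 <= f x) ->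
  measurable E -> 0 < mu E -> (forall x, E x -> 0 < f x) ->
  0 < \int[mu]_x f x.
Proof.
move=> mf f0 mE muE fE; rewrite lt0e integral_ge0// andbT.
apply/eqP => I0.
have : ae_eq mu setT f (cst 0).
  apply/(ae_eq_integral_abs mu measurableT mf).
  by rewrite -[RHS]I0; apply: eq_integral => x _; rewrite gee0_abs.
case=> N [mN N0 subN].
have : mu E <= mu N.
  apply: le_measure; rewrite ?inE// => x Ex; apply: subN => /= /(_ I) fx0.
  by have := fE x Ex; rewrite fx0 ltxx.
by rewrite N0 leNgt muE.
Qed.

End nonneg_integral.

(** * Affine changes of variable on the line *)

Section affine_substitution.
Local Open Scope ereal_scope.
Context (R : realType).
Local Notation mu := (@lebesgue_measure R).

(** Uniqueness of Lebesgue measure: the rescaled image measure gives every half-open interval its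
    length. *)
Lemma lebesgue_measure_affine (a b : R) (A : set R) : (0 < a)%R ->
  measurable A ->
  a%:E * mu [set x | A (a * x + b)%R] = mu A.
Proof.
move=> a0 mA; pose phi : measurableTypeR R -> measurableTypeR R := fun x => (a * x + b)%R.
have mphi : measurable_fun setT phi.
  by apply: measurable_funD => //; exact: measurable_funM.
transitivity (pushforward (mscale (NngNum (ltW a0)) mu) phi A) => //.
apply/esym; apply: lebesgue_measure_unique => //.
move=> _ [[u v]] _ <-.
rewrite /pushforward /mscale/=.
transitivity (a%:E * mu [set` `]((u - b) / a)%R, ((v - b) / a)%R]%R]); last first.
  congr (_ * mu _); apply/seteqP; split => x /=;
    rewrite !in_itv/= ltr_pdivrMr// ler_pdivlMr//;
    by rewrite ltrBlDr lerBrDr (mulrC x).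
rewrite !lebesgue_measure_itv/= !lte_fin ltr_pM2r ?invr_gt0// ltrD2r.
case: ifPn => _; last by rewrite mule0.
by rewrite -!EFinB -EFinM; congr EFin; field; rewrite gt_eqF.
Qed.

Lemma ge0_integral_affine (a b : R) (f : R -> \bar R) : (a != 0)%R ->
  measurable_fun setT f -> (forall x, 0 <= f x) ->
  \int[mu]_x f (a * x + b)%R = `|a|^-1%:E * \int[mu]_x f x.
Proof.
have pos (a' : R) (g : R -> \bar R) : (0 < a')%R ->
  measurable_fun setT g -> (forall x, 0 <= g x) ->
  \int[mu]_x g (a' * x + b)%R = a'^-1%:E * \int[mu]_x g x.
  move=> a0 mg g0.
  pose phi : measurableTypeR R -> measurableTypeR R := fun x => (a' * x + b)%R.
  have mphi : measurable_fun setT phi.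
    by apply: measurable_funD => //; exact: measurable_funM.
  have := @ge0_integral_pushforward _ _ _ _ R phi mphi mu setT g measurableT mg.
  move=> /(_ (fun y _ => g0 y)); rewrite preimage_setT /= /comp => <-.
  have a0' : (0 <= a'^-1)%R by rewrite invr_ge0 ltW.
  rewrite -[RHS](@ge0_integral_mscale _ _ R mu setT measurableT (NngNum a0') g mg)//.
  apply: (@eq_measure_integral _ _ _ _ (mscale (NngNum a0') mu)
    (pushforward mu phi)) => // A mA _.
  have H := @lebesgue_measure_affine a' b A a0 mA.
  transitivity (a'^-1%:E * (a'%:E * mu [set x | A (a' * x + b)%R])).
    by rewrite muleA -EFinM mulVf ?gt_eqF// mul1e.
  by congr (_ * _).
move=> a0 mf f0; have [agt|] := ltP 0%R a.
  by rewrite gtr0_norm// pos.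
(* A negative slope reduces to [- a] by reflecting the line, which preserves the measure. *)
rewrite le_eqVlt (negbTE a0)/= => alt.
rewrite ltr0_norm// -pos//; last by rewrite oppr_gt0.
have mg : measurable_fun [set: R] (fun x => f (- a * x + b)%R).
  apply: measurableT_comp => //; apply: measurable_funD => //; exact: measurable_funM.
have mN : measurable_fun setT (-%R : measurableTypeR R -> measurableTypeR R) by [].
have := @ge0_integral_pushforward _ _ _ _ R (-%R : measurableTypeR R -> measurableTypeR R)
  mN mu setT _ measurableT mg.
move=> /(_ (fun y _ => f0 _)).
rewrite preimage_setT /comp /= => E.
transitivity (\int[mu]_x f (- a * - x + b)%R).
  by apply: eq_integral => x _; rewrite mulrNN.
rewrite -E; apply: eq_measure_integral => A mA _.
exact: lebesgue_measureN.
Qed.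

End affine_substitution.

(** * Tonelli's theorem for [iint] *)

Section iterated_integral.
Local Open Scope ereal_scope.
Context (R : realType).
Local Notation mu := (@lebesgue_measure R).
Implicit Types (v w : nat -> R) (n k : nat).

(** The vector that [iint] builds, up to conversion, so that [iintS] holds by computation. *)
Definition vcons (t : R) v : nat -> R := fun i => if i is j.+1 then v j else t.

Lemma iintS n (F : (nat -> R) -> \bar R) :
  iint n.+1 F = \int[mu]_t iint n (fun v => F (vcons t v)).
Proof. by []. Qed.

Definition seq_measurable d (S : measurableType d) (c : S -> nat -> R) :=
  forall i, measurable_fun setT (fun s => c s i).

(* The vectors [nat -> R] carry no sigma-algebra: measurability of a function of
   a vector is tested along all coordinatewise measurable families of vectors. *)
Definition vec_measurable (F : (nat -> R) -> \bar R) :=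
  forall d (S : measurableType d) (c : S -> nat -> R),
    seq_measurable c -> measurable_fun setT (fun s => F (c s)).

(** Pulling the parameter back along [phi] keeps the notion stable when integration variables join
    the parameter space one at a time. *)
Definition param_measurable d (S : measurableType d) (G : S -> (nat -> R) -> \bar R) :=
  forall d' (S' : measurableType d') (phi : S' -> S) (c : S' -> nat -> R),
    measurable_fun setT phi -> seq_measurable c ->
    measurable_fun setT (fun s => G (phi s) (c s)).

Lemma seq_measurable_vcons d (S : measurableType d) (t : S -> R)
    (c : S -> nat -> R) :
  measurable_fun setT t -> seq_measurable c ->
  seq_measurable (fun s => vcons (t s) (c s)).
Proof. by move=> mt mc [|i]; [exact: mt | exact: mc]. Qed.

Lemma iint_ge0 n (F : (nat -> R) -> \bar R) :
  (forall v, 0 <= F v) -> 0 <= iint n F.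
Proof.
elim: n F => [|n IH] F F0; first exact: F0.
by apply: integral_ge0 => t _; exact: IH.
Qed.

Lemma le_iint n (F G : (nat -> R) -> \bar R) :
  (forall v, 0 <= F v) -> (forall v, F v <= G v) -> iint n F <= iint n G.
Proof.
elim: n F G => [|n IH] F G F0 FG; first exact: FG.
apply: ge0_le_integralT => t; first exact: iint_ge0.
exact: IH.
Qed.

Lemma eq_iint n (F G : (nat -> R) -> \bar R) : F =1 G -> iint n F = iint n G.
Proof. by move=> /funext ->. Qed.

Lemma iint0 n : iint n (fun=> 0) = 0 :> \bar R.
Proof.
elim: n => [//|n IH]; rewrite iintS.
by under eq_integral do rewrite IH; rewrite integral0.
Qed.

Lemma param_measurable_vcons d (S : measurableType d) (G : S -> (nat -> R) -> \bar R) :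
  param_measurable G ->
  param_measurable (fun (p : S * measurableTypeR R) v => G p.1 (vcons p.2 v)).
Proof.
move=> mG d' S' phi c mphi mc; apply: (mG _ _ (fun s => (phi s).1)).
  exact: measurableT_comp.
by apply: seq_measurable_vcons => //; exact: measurableT_comp.
Qed.

(** The first variable joins the parameters; the induction hypothesis gives joint measurability, and
    one-variable Tonelli integrates it out. *)
Lemma measurable_iint n d (S : measurableType d)
    (G : S -> (nat -> R) -> \bar R) :
  param_measurable G -> (forall s v, 0 <= G s v) ->
  measurable_fun setT (fun s => iint n (G s)).
Proof.
elim: n d S G => [|n IH] d S G mG G0.
  by apply: (mG _ S id (fun _ _ => 0%R)) => // i; exact: measurable_cst.
apply: (@measurable_fun_fubini_tonelli_F _ _ S _ R mu
  (fun p => iint n (fun v => G p.1 (vcons p.2 v)))) => [|p].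
  by apply: IH => //; exact: param_measurable_vcons.
exact: iint_ge0.
Qed.

Lemma param_measurable_iint n d (S : measurableType d)
    (G : S -> (nat -> R) -> (nat -> R) -> \bar R) :
  (forall d' (S' : measurableType d') (phi : S' -> S) (c c' : S' -> nat -> R),
    measurable_fun setT phi -> seq_measurable c -> seq_measurable c' ->
    measurable_fun setT (fun s => G (phi s) (c s) (c' s))) ->
  (forall s v w, 0 <= G s v w) ->
  param_measurable (fun s v => iint n (G s v)).
Proof.
move=> mG G0 d' S' phi c mphi mc; apply: measurable_iint => //.
move=> d2 S2 psi c2 mpsi mc2; apply: mG => //.
  exact: measurableT_comp.
by move=> i; exact: measurableT_comp (mc i) mpsi.
Qed.

(** Tonelli moves the outer integral past one variable of [iint] at a time. *)
Lemma integral_iint n d (S : measurableType d)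
    (nu : {sigma_finite_measure set S -> \bar R})
    (G : S -> (nat -> R) -> \bar R) :
  param_measurable G -> (forall s v, 0 <= G s v) ->
  \int[nu]_s iint n (G s) = iint n (fun v => \int[nu]_s G s v).
Proof.
elim: n G => [//|n IH] G mG G0.
have := @fubini_tonelli _ _ S _ R nu mu
  (fun p => iint n (fun v => G p.1 (vcons p.2 v))).
rewrite iintS => -> /=.
- apply: eq_integral => t _; rewrite IH// => d' S' phi c mphi mc.
  by apply: mG => //; exact: seq_measurable_vcons.
- by apply: measurable_iint => //; exact: param_measurable_vcons.
- by move=> p; exact: iint_ge0.
Qed.

Definition bimeasurable (F : (nat -> R) -> (nat -> R) -> \bar R) :=
  forall d (S : measurableType d) (c c' : S -> nat -> R),
    seq_measurable c -> seq_measurable c' ->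
    measurable_fun setT (fun s => F (c s) (c' s)).

Lemma vec_measurable_iint n (F : (nat -> R) -> (nat -> R) -> \bar R) :
  bimeasurable F -> (forall v w, 0 <= F v w) ->
  vec_measurable (fun v => iint n (F v)).
Proof.
move=> mF F0 d S c mc; apply: measurable_iint => // d' S' phi c' mphi mc'.
by apply: mF => // i; exact: (measurableT_comp (mc i) mphi).
Qed.

Lemma iint_iintC n k (F : (nat -> R) -> (nat -> R) -> \bar R) :
  bimeasurable F -> (forall v w, 0 <= F v w) ->
  iint n (fun v => iint k (F v)) = iint k (fun w => iint n (F^~ w)).
Proof.
elim: n F => [//|n IH] F mF F0; rewrite iintS.
under eq_integral => t _.
  rewrite IH//; last first.
    by move=> d S c c' mc mc'; apply: mF => //; exact: seq_measurable_vcons.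
  over.
rewrite integral_iint//; last by move=> s v; exact: iint_ge0.
apply: param_measurable_iint => // d' S' phi c c' mphi mc mc'.
by apply: mF => //; exact: seq_measurable_vcons.
Qed.

Lemma iint_gt0 n (F : (nat -> R) -> \bar R) :
  vec_measurable F -> (forall v, 0 < F v) -> 0 < iint n F.
Proof.
elim: n F => [|n IH] F mF F0; first exact: F0.
(* The inner integral is positive at every [t], so any set of positive measure serves. *)
rewrite iintS; apply: (@integral_gt0 _ (measurableTypeR R) R mu _ `]0%R, 1%R[%classic).
- apply: measurable_iint => [|t v]; last exact: ltW.
  by move=> d S phi c mphi mc; apply: mF; exact: seq_measurable_vcons.
- by move=> t; apply: iint_ge0 => v; exact: ltW.
- by [].
- by rewrite /= lebesgue_measure_itv/= lte_fin ltr01 oppr0 adde0 lte_fin ltr01.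
- move=> t _; apply: IH => // d S c mc.
  by apply: mF; exact: seq_measurable_vcons.
Qed.

Lemma ge0_iintZl n (k : R) (F : (nat -> R) -> \bar R) :
  vec_measurable F -> (forall v, 0 <= F v) -> (0 <= k)%R ->
  iint n (fun v => k%:E * F v) = k%:E * iint n F.
Proof.
elim: n F => [//|n IH] F mF F0 k0; rewrite !iintS -ge0_integralZl//.
- apply: eq_integral => t _; rewrite IH// => d S c mc.
  by apply: mF; exact: seq_measurable_vcons.
- apply: measurable_iint => // d S phi c mphi mc; apply: mF.
  exact: seq_measurable_vcons.
- by move=> t _; exact: iint_ge0.
Qed.

(** Each variable occurs in one factor only, so the factors come out one by one; finiteness makes
    [fine] faithful. *)
Lemma iint_prod n (h : 'I_n -> R -> R) :
  (forall i, measurable_fun setT (h i)) -> (forall i t, 0 <= h i t)%R ->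
  (forall i, \int[mu]_t (h i t)%:E < +oo) ->
  iint n (fun v => (\prod_(i < n) h i (v i))%:E)
  = (\prod_(i < n) fine (\int[mu]_t (h i t)%:E))%:E.
Proof.
elim: n h => [|n IH] h mh h0 hfin; first by rewrite /= !big_ord0.
rewrite big_ord_recl EFinM fineK; last first.
  by rewrite ge0_fin_numE ?hfin// integral_ge0// => t _; rewrite lee_fin.
rewrite -IH// muleC iintS.
under eq_integral => t _.
  under eq_iint do rewrite big_ord_recl EFinM /=.
  rewrite ge0_iintZl//; last 2 first.
    move=> d S c mc; apply/measurable_EFinP.
    by apply: measurable_prod => i _; exact: measurableT_comp.
    by move=> v; rewrite lee_fin prodr_ge0.
  rewrite muleC.
  over.
rewrite ge0_integralZl//.
- by apply/(@measurable_EFinP _ (measurableTypeR R) R); exact: mh.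
- by move=> t _; rewrite lee_fin.
- by apply: iint_ge0 => v; rewrite lee_fin prodr_ge0.
Qed.

End iterated_integral.

(** * Products of functions of linear forms *)

Section linear_forms.
Context (R : realType).
Local Notation mu := (@lebesgue_measure R).

Definition linform (r : nat) (a b : nat -> R) : R := \sum_(j < r) a j * b j.

Lemma linformS r a b :
  linform r.+1 a b = a 0%N * b 0%N + linform r (fun j => a j.+1) (fun j => b j.+1).
Proof. by rewrite /linform big_ord_recl. Qed.

Lemma linform_comb r a a' k b :
  linform r (fun j => a j - k * a' j) b = linform r a b - k * linform r a' b.
Proof.
rewrite /linform mulr_sumr -sumrB; apply: eq_bigr => j _.
by rewrite mulrBl mulrA.
Qed.

Lemma measurable_linform r a d (S : measurableType d) (c : S -> nat -> R) :
  seq_measurable c -> measurable_fun setT (fun s => linform r a (c s)).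
Proof.
move=> mc; apply: measurable_sum => j; apply: measurable_funM => //.
Qed.

(** Full column rank as a trivial kernel, the form that elimination preserves; the conclusion stops
    at [r] because [linform r] sees only these coordinates. *)
Definition injective_rows (m r : nat) (X : 'I_m -> nat -> R) :=
  forall b, (forall i, linform r (X i) b = 0) ->
    forall j, (j < r)%N -> b j = 0.

(* One step of Gaussian elimination: the pivot row [i] absorbs the variable [t],
   and the remaining rows become affine in the other variables. *)
Lemma iint_linform_bound (r m : nat) (X : 'I_m -> nat -> R) :
  injective_rows r X ->
  exists2 C : R, 0 <= C & forall (c : R) (f : 'I_m -> R -> R),
    0 <= c -> (forall i, measurable_fun setT (f i)) ->
    (forall i x, 0 <= f i x <= c) ->
    (forall i, \int[mu]_x (f i x)%:E <= 1)%E ->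
    (iint r (fun b => (\prod_(i < m) f i (linform r (X i) b))%:E)
      <= (C * c ^+ (m - r))%:E)%E.
Proof.
elim: r m X => [|r IH] m X kerX.
  (* With no variable left, each of the [m] factors is bounded by [c]. *)
  exists 1 => // c f c0 mf fc f1.
  rewrite /= lee_fin mul1r subn0 -[in leRHS](card_ord m) -prodr_const.
  by apply: ler_prod => i _; exact: fc.
(* If the first column vanished, the first unit vector would lie in the kernel. *)
have [i Xi0] : exists i, X i 0%N != 0.
  apply/not_existsP => X0.
  have : vcons 1 (fun=> 0) 0%N = 0 :> R.
    apply: (kerX (vcons 1 (fun=> 0))) => // i.
    rewrite linformS /=; have /negP/negPn/eqP -> := X0 i.
    by rewrite mul0r add0r /linform big1// => j _; rewrite mulr0.
  by move/eqP; rewrite oner_eq0.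
case: m X kerX i Xi0 => [X _ [//]|m] X kerX i Xi0.
pose x0 := X i 0%N.
pose q k := X (lift i k) 0%N / x0.
pose Xi j := X i j.+1.
pose X' k j := X (lift i k) j.+1 - q k * Xi j.
have kerX' : injective_rows r X'.
  (* This [t] annihilates the pivot row, so a kernel vector of [X'] extends to one of [X]. *)
  move=> b bX' j jr; pose t := - linform r Xi b / x0.
  apply: (kerX (vcons t b) _ j.+1) => // k.
  rewrite linformS /=; case: (unliftP i k) => [k' ->|->].
    have := bX' k'; rewrite linform_comb => /eqP; rewrite subr_eq0 => /eqP ->.
    by rewrite /q /t -/Xi; field.
  by rewrite -/x0 /t; field.
have [C C0 HC] := IH m X' kerX'.
(* The factor [1 / |x0|] is the Jacobian of the substitution [u = x0 * t + linform r Xi v]. *)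
exists (C / `|x0|) => [|c f c0 mf fc f1]; first by rewrite divr_ge0.
have f0 k x : 0 <= f k x by have /andP[] := fc k x.
rewrite subSS iintS integral_iint; last 2 first.
- move=> d S phi b mphi mb; apply/measurable_EFinP; apply: measurable_prod => k _.
  apply: measurableT_comp => //; apply: measurable_linform.
  exact: seq_measurable_vcons.
- by move=> t v; rewrite lee_fin prodr_ge0.
(* The integrand in the new variable [u], the value of the pivot form; row [lift i k] becomes
   [q k * u] plus a form in [v] alone. *)
pose G v u := f i u * \prod_(k < m) f (lift i k) (q k * u + linform r (X' k) v).
have G0 v u : 0 <= G v u by rewrite mulr_ge0// prodr_ge0.
have mG d (S : measurableType d) (phi : S -> measurableTypeR R) b :
    measurable_fun setT phi -> seq_measurable b ->
    measurable_fun setT (fun s => G (b s) (phi s)).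
  move=> mphi mb; apply: measurable_funM; first exact: (measurableT_comp (mf i) mphi).
  apply: measurable_prod => k _; apply: measurableT_comp => //.
  by apply: measurable_funD; [exact: measurable_funM|exact: measurable_linform].
have -> : (fun v => \int[mu]_t
    (\prod_(k < m.+1) f k (linform r.+1 (X k) (vcons t v)))%:E)%E
  = (fun v => `|x0|^-1%:E * \int[mu]_u (G v u)%:E)%E.
  apply/funext => v.
  rewrite -(@ge0_integral_affine R x0 (linform r Xi v) (fun u => (G v u)%:E))//; last 2 first.
  - by apply/measurable_EFinP; apply: (mG _ _ id (fun=> v)).
  - by move=> u; rewrite lee_fin.
  apply: eq_integral => t _; congr EFin; rewrite (bigD1_ord i)//= /G.
  congr (f i _ * _); first by rewrite linformS.
  apply: eq_bigr => k _; congr (f _ _); rewrite linformS /= linform_comb.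
  by rewrite -/Xi /q; field.
rewrite ge0_iintZl ?invr_ge0//; last 2 first.
- move=> d S b mb.
  apply: (@measurable_fun_fubini_tonelli_F _ _ S _ R mu (fun p => (G (b p.1) p.2)%:E)) => [|p].
    apply/measurable_EFinP; apply: (mG _ _ snd (fun p => b p.1)) => // j.
    exact: (measurableT_comp (mb j) measurable_fst).
  by rewrite lee_fin.
- by move=> v; apply: integral_ge0 => u _; rewrite lee_fin.
rewrite mulrAC (mulrC _ (`|x0|^-1)) EFinM; apply: lee_wpmul2l.
  by rewrite lee_fin invr_ge0.
(* With [u] outermost and fixed, the remaining factors are translates of the functions [f], so the
   induction hypothesis bounds their integral uniformly in [u]. *)
rewrite -(@integral_iint R r _ _ mu (fun u v => (G v u)%:E)); last 2 first.
- by move=> d S phi b mphi mb; apply/measurable_EFinP; exact: mG.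
- by move=> u v; rewrite lee_fin.
have K0 : 0 <= C * c ^+ (m - r) by rewrite mulr_ge0// exprn_ge0.
apply: (@le_trans _ _ (\int[mu]_u ((f i u)%:E * (C * c ^+ (m - r))%:E))%E).
  apply: ge0_le_integralT => u; first by apply: iint_ge0 => v; rewrite lee_fin.
  under eq_iint do rewrite /G EFinM.
  rewrite ge0_iintZl//; last 2 first.
  - move=> d S b mb; apply/measurable_EFinP; apply: measurable_prod => k _.
    apply: measurableT_comp => //; apply: measurable_funD => //.
    exact: measurable_linform.
  - by move=> v; rewrite lee_fin prodr_ge0.
  apply: lee_wpmul2l; first by rewrite lee_fin.
  apply: (HC c (fun k x => f (lift i k) (q k * u + x))) => // k.
    by apply: measurableT_comp => //; exact: measurable_funD.
  have /= := @ge0_integral_affine R 1 (q k * u) (fun x => (f (lift i k) x)%:E).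
  under eq_integral do rewrite mul1r addrC.
  move=> -> //; first by rewrite normr1 invr1 mul1e.
    exact/measurable_EFinP.
  by move=> x; rewrite lee_fin.
rewrite ge0_integralZr//; last 2 first.
- by apply/(@measurable_EFinP _ (measurableTypeR R) R); exact: mf.
- by move=> u _; rewrite lee_fin.
(* The pivot factor contributes its integral, at most 1, instead of [c]: each variable saves one
   power of [c]. *)
by rewrite -[leRHS]mul1e; apply: lee_wpmul2r.
Qed.

End linear_forms.

(** * Integrals of powers *)

Lemma measurable_fun_powR (R : realType) d (S : measurableType d) (e : R)
    (g : S -> R) :
  measurable_fun setT g -> measurable_fun setT (fun s => g s `^ e).
Proof. by move=> mg; exact: (measurableT_comp (@measurable_powR R e) mg). Qed.

Section power_integrals.
Context (R : realType).
Local Notation mu := (@lebesgue_measure R).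

(** Monotone convergence: carries a uniform bound from compact intervals, where the fundamental
    theorem of calculus applies, to their union. *)
Lemma integral_nondecreasing_bigcup_le (F : nat -> set R) (f : R -> \bar R) (K : \bar R) :
  nondecreasing_seq F -> (forall n, measurable (F n)) ->
  measurable_fun setT f -> (forall x, (0 <= f x)%E) ->
  (forall n, (\int[mu]_(x in F n) f x <= K)%E) ->
  (\int[mu]_(x in \bigcup_n F n) f x <= K)%E.
Proof.
move=> ndF mF mf f0 FK.
have cv : (\int[mu]_(x in F i) f x)%E @[i --> \oo] --> (\int[mu]_(x in \bigcup_i F i) f x)%E.
  apply: (@ge0_nondecreasing_set_cvg_integral _ (measurableTypeR R)) => // i.
  exact: measurable_funTS.
rewrite -(cvg_lim _ cv)//; apply: lime_le; first by apply/cvg_ex; eexists; exact: cv.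
exact: nearW.
Qed.

Lemma integral_powR_itv (e a b : R) : e + 1 != 0 -> 0 < a -> a < b ->
  (\int[mu]_(x in `[a, b]) (x `^ e)%:E
   = ((b `^ (e + 1) - a `^ (e + 1)) / (e + 1))%:E)%E.
Proof.
move=> e1 a0 ab.
have dP (c x : R) : 0 < x -> derivable (fun x => x `^ c) x 1.
  by move=> x0; apply: derivable_powR; rewrite in_itv/= x0.
pose G (x : R) : R := (e + 1)^-1 * x `^ (e + 1).
have dG (x : R) : 0 < x -> derivable G x 1 by move=> x0; apply: derivableM => //; exact: dP.
have cG (x : R) : 0 < x -> G z @[z --> x] --> G x.
  by move=> x0; apply/differentiable_continuous/derivable1_diffP/dG.
rewrite (@continuous_FTC2 R _ G)//.
- by rewrite -EFinB /G; congr EFin; field.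
- apply: derivable_within_continuous => x; rewrite in_itv/= => /andP[ax _].
  by apply: dP; exact: lt_le_trans ax.
- split.
  + by move=> x; rewrite in_itv/= => /andP[ax _]; apply: dG; exact: lt_trans ax.
  + apply: cvg_at_right_filter; exact: cG.
  + apply: cvg_at_left_filter; apply: cG; exact: lt_trans ab.
- move=> x; rewrite in_itv/= => /andP[ax _].
  have x0 : 0 < x by exact: lt_trans ax.
  rewrite derive1E deriveM//; last exact: dP.
  rewrite derive_cst scaler0 addr0 -derive1E powR_derive1 ?in_itv/= ?x0//.
  by rewrite addrK /GRing.scale/= mulrA mulVf ?mul1r.
Qed.

Lemma integral_powR_tail_le (e a : R) : e + 1 < 0 -> 0 < a ->
  (\int[mu]_(x in `[a, +oo[) (x `^ e)%:E <= (a `^ (e + 1) / - (e + 1))%:E)%E.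
Proof.
move=> e1 a0; rewrite itv_bndy_bigcup_BRight.
have K0 : 0 <= a `^ (e + 1) / - (e + 1).
  by rewrite divr_ge0 ?powR_ge0// oppr_ge0 ltW.
apply: integral_nondecreasing_bigcup_le => //.
- move=> k n kn; apply/subsetPset; apply: subset_itvl; rewrite bnd_simp.
  by rewrite lerD2l ler_nat.
- apply/measurable_EFinP; exact: measurable_powR.
- by move=> x; rewrite lee_fin powR_ge0.
- case=> [|n].
    by rewrite addr0 set_itv1 integral_set1 lee_fin.
  rewrite integral_powR_itv ?lt_eqF// ?ltrDl ?ltr0n// lee_fin.
  (* As [e + 1 < 0], numerator and denominator both change sign before the term at the right
     endpoint is dropped. *)
  rewrite -[leLHS]mulrNN -invrN ler_wpM2r ?invr_ge0 ?oppr_ge0 ?(ltW e1)//.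
  by rewrite opprB gerBl powR_ge0.
Qed.

Lemma integral_powR_head_le (e b : R) : 0 < e + 1 -> 0 < b ->
  (\int[mu]_(x in `]0%R, b]) (x `^ e)%:E <= (b `^ (e + 1) / (e + 1))%:E)%E.
Proof.
move=> e1 b0; rewrite itv_open_bnd_bigcup.
have K0 : 0 <= b `^ (e + 1) / (e + 1) by rewrite divr_ge0 ?powR_ge0// ltW.
apply: integral_nondecreasing_bigcup_le => //.
- move=> k n kn; apply/subsetPset; apply: subset_itvr; rewrite bnd_simp.
  by rewrite !add0r lef_pV2 ?posrE ?ltr0n// ler_nat.
- apply/measurable_EFinP; exact: measurable_powR.
- by move=> x; rewrite lee_fin powR_ge0.
(* For small [n] the left endpoint [1 / (n + 1)] may reach or exceed [b]; the piece is then a point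
   or empty. *)
- move=> n; rewrite add0r; have [nb|bn|nb] := ltgtP n.+1%:R^-1 b.
  + rewrite integral_powR_itv ?gt_eqF// ?invr_gt0 ?ltr0n// lee_fin.
    by rewrite ler_wpM2r ?invr_ge0 ?(ltW e1)// gerBl powR_ge0.
  + by rewrite set_itv_ge ?integral_set0 ?lee_fin// bnd_simp -ltNge.
  + by rewrite nb set_itv1 integral_set1 lee_fin.
Qed.

End power_integrals.

(** * Normal convolutions and the prior *)

Section normal_convolution.
Context (R : realType).
Local Notation mu := (@lebesgue_measure R).

(** For [V > 0], the maximum of the normal density of variance [V]. *)
Definition peak (V : R) : R := (V * (pi *+ 2)) `^ (- 2^-1).

Lemma peak_ge0 V : 0 <= peak V.
Proof. exact: powR_ge0. Qed.

Lemma normal_peakE (V : R) : 0 < V -> normal_peak (Num.sqrt V) = peak V.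
Proof.
move=> V0; rewrite /normal_peak sqr_sqrtr ?(ltW V0)// /peak powRN powR12_sqrt.
  by rewrite -mulrnAr.
by rewrite mulr_ge0 ?(ltW V0)// mulrn_wge0// pi_ge0.
Qed.

Lemma le_peak (U V : R) : 0 < U -> U <= V -> peak V <= peak U.
Proof.
move=> U0 UV; have p0 : 0 < pi *+ 2 :> R by rewrite mulrn_wgt0// pi_gt0.
have V0 : 0 < V by exact: lt_le_trans UV.
rewrite /peak !powRN lef_pV2 ?posrE ?powR_gt0 ?mulr_gt0//.
by apply: ge0_ler_powR;
  rewrite ?nnegrE ?mulr_ge0 ?(ltW U0) ?(ltW V0) ?(ltW p0) ?ler_pM2r ?invr_ge0.
Qed.

(** Powers replace square root and inverse, so that measurability in the variance follows from that
    of [powR]. *)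
Lemma npdfE (m V x : R) : 0 < V ->
  npdf m V x = peak V * expR (- (x - m) ^+ 2 * (V *+ 2) `^ (-1)).
Proof.
move=> V0; rewrite /npdf normal_pdfE ?gt_eqF ?sqrtr_gt0// normal_peakE//.
by rewrite /normal_fun sqr_sqrtr ?(ltW V0)// powR_inv1 ?mulrn_wge0// ltW.
Qed.

Lemma npdf_gt0 (m V x : R) : 0 < V -> 0 < npdf m V x.
Proof.
move=> V0; rewrite npdfE// mulr_gt0 ?expR_gt0// /peak powR_gt0// mulr_gt0//.
by rewrite mulrn_wgt0// pi_gt0.
Qed.

Lemma npdf_le_peak (m V x : R) : 0 < V -> npdf m V x <= peak V.
Proof.
by move=> V0; rewrite /npdf -normal_peakE// normal_pdf_ub// gt_eqF ?sqrtr_gt0.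
Qed.

Lemma npdfC (m V x : R) : 0 < V -> npdf m V x = npdf x V m.
Proof. by move=> V0; rewrite !npdfE// -sqrrN opprB. Qed.

Lemma integral_npdf (m V : R) : (\int[mu]_x (npdf m V x)%:E)%E = 1%E.
Proof. exact: integral_normal_pdf. Qed.

Lemma integral_npdf_mean (V x : R) : 0 < V -> (\int[mu]_m (npdf m V x)%:E)%E = 1%E.
Proof.
move=> V0; rewrite -[RHS](integral_npdf x V).
by apply: eq_integral => m _; rewrite npdfC.
Qed.

Lemma measurable_gauss d (S : measurableType d) (m V x : S -> R) :
  measurable_fun setT m -> measurable_fun setT V -> measurable_fun setT x ->
  measurable_fun setT
    (fun s => peak (V s) * expR (- (x s - m s) ^+ 2 * (V s *+ 2) `^ (-1))).
Proof.
move=> mm mV mx.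
apply: measurable_funM.
  rewrite /peak; apply: measurable_fun_powR; exact: measurable_funM.
apply: measurableT_comp => //; apply: measurable_funM.
  apply: measurableT_comp => //; apply: measurable_funX; exact: measurable_funB.
apply: measurable_fun_powR.
by under eq_fun do rewrite mulr2n; exact: measurable_funD.
Qed.

Lemma measurable_npdf (V : R) d (S : measurableType d) (m x : S -> R) : 0 < V ->
  measurable_fun setT m -> measurable_fun setT x ->
  measurable_fun setT (fun s => npdf (m s) V (x s)).
Proof.
move=> V0 mm mx; under eq_fun do rewrite npdfE//.
exact: (@measurable_gauss _ _ m (cst V) x).
Qed.

(** The likelihood of one area with [theta] integrated out: for positive variances, the normal
    density at [y] with mean [x] and variance [D + V]. *)
Definition npdf_conv (y D V x : R) : \bar R :=
  (\int[mu]_t (npdf t D y * npdf x V t)%:E)%E.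

Section conv.
Variables (y D V : R).
Hypotheses (D0 : 0 < D) (V0 : 0 < V).

Let prod_ge0 t x : 0 <= npdf t D y * npdf x V t.
Proof. by rewrite mulr_ge0// ltW// npdf_gt0. Qed.

Lemma npdf_conv_ge0 x : (0 <= npdf_conv y D V x)%E.
Proof. by apply: integral_ge0 => t _; rewrite lee_fin. Qed.

(** Bounding one factor by its peak leaves the other, of total mass 1; here the second factor is
    bounded, in the next lemma the first. *)
Lemma npdf_conv_le_peakV x : (npdf_conv y D V x <= (peak V)%:E)%E.
Proof.
apply: (@le_trans _ _ (\int[mu]_t ((npdf t D y)%:E * (peak V)%:E)))%E.
  apply: ge0_le_integralT => t; rewrite lee_fin//.
  by rewrite ler_wpM2l ?npdf_le_peak// ltW// npdf_gt0.
rewrite ge0_integralZr ?lee_fin ?peak_ge0//.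
- by rewrite integral_npdf_mean// mul1e.
- apply/measurable_EFinP; exact: measurable_npdf.
- by move=> t _; rewrite lee_fin ltW// npdf_gt0.
Qed.

Lemma npdf_conv_le_peakD x : (npdf_conv y D V x <= (peak D)%:E)%E.
Proof.
apply: (@le_trans _ _ (\int[mu]_t ((peak D)%:E * (npdf x V t)%:E)))%E.
  apply: ge0_le_integralT => t; rewrite lee_fin//.
  by rewrite ler_wpM2r ?npdf_le_peak// ltW// npdf_gt0.
rewrite ge0_integralZl ?lee_fin ?peak_ge0//.
- by rewrite integral_npdf mule1.
- apply/measurable_EFinP; exact: measurable_npdf.
- by move=> t _; rewrite lee_fin ltW// npdf_gt0.
Qed.

Lemma npdf_conv_fin_num x : npdf_conv y D V x \is a fin_num.
Proof.
rewrite ge0_fin_numE ?npdf_conv_ge0//.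
exact: le_lt_trans (npdf_conv_le_peakV x) (ltry _).
Qed.

Let measurable_conv_prod : measurable_fun setT
  (fun p : measurableTypeR R * measurableTypeR R =>
    (npdf p.2 D y * npdf p.1 V p.2)%:E).
Proof.
apply/measurable_EFinP; apply: measurable_funM; exact: measurable_npdf.
Qed.

Lemma measurable_npdf_conv : measurable_fun setT (npdf_conv y D V).
Proof.
apply: (@measurable_fun_fubini_tonelli_F _ _ (measurableTypeR R)
  (measurableTypeR R) R mu _ measurable_conv_prod) => p.
by rewrite lee_fin.
Qed.

(** By Tonelli, [x] is integrated first, as the mean of the second factor, then [t], as the mean of
    the first. *)
Lemma integral_npdf_conv : (\int[mu]_x npdf_conv y D V x)%E = 1%E.
Proof.
have := @fubini_tonelli _ _ (measurableTypeR R)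
  (measurableTypeR R) R mu mu _ measurable_conv_prod.
move=> -> /=; last by move=> p; rewrite lee_fin.
rewrite -[RHS](@integral_npdf_mean D y)//; apply: eq_integral => t _.
under eq_integral do rewrite EFinM.
rewrite ge0_integralZl ?lee_fin//.
- by rewrite integral_npdf_mean// mule1.
- apply/measurable_EFinP; exact: measurable_npdf.
- by move=> x _; rewrite lee_fin ltW// npdf_gt0.
- by rewrite ltW// npdf_gt0.
Qed.

End conv.

End normal_convolution.

(** * Integrability of the prior against the likelihood bound *)

Section prior.
Context (R : realType).
Local Notation mu := (@lebesgue_measure R).

Definition in_support (A1 A2 p : R) :=
  (0 < A1) && (A1 < A2) && (0 < p) && (p < 1).

Lemma measurable_in_support d (S : measurableType d) (A1 A2 p : S -> R) :
  measurable_fun setT A1 -> measurable_fun setT A2 -> measurable_fun setT p ->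
  measurable_fun setT (fun s => in_support (A1 s) (A2 s) (p s)).
Proof.
move=> mA1 mA2 mp; apply: measurable_and; last exact: measurable_fun_ltr.
apply: measurable_and; last exact: measurable_fun_ltr.
by apply: measurable_and; exact: measurable_fun_ltr.
Qed.

(** The prior times the bound left once [theta] and [beta] are integrated out, up to a constant; [n]
    will be [m - r]. *)
Definition prior_weight (alpha1 alpha2 K : R) (n : nat) (A1 A2 p : R) : \bar R :=
  if in_support A1 A2 p then
    (A1 `^ (- alpha1) * A2 `^ (- alpha2) * Num.min (peak A1) K ^+ n)%:E
  else 0%E.

Lemma peakX (A : R) n : 0 < A ->
  peak A ^+ n = (pi *+ 2) `^ (- 2^-1) ^+ n * A `^ (- (n%:R / 2)).
Proof.
move=> A0; have p0 : 0 <= pi *+ 2 :> R by rewrite mulrn_wge0// pi_ge0.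
rewrite /peak (powRM _ (ltW A0) p0) exprMn mulrC; congr (_ * _).
by rewrite -powR_mulrn ?powR_ge0// -powRrM mulrC mulrN.
Qed.

Lemma prior_integral_lty (alpha1 alpha2 K : R) n : 0 <= K ->
  1 < alpha2 -> 0 < 2 - alpha1 - alpha2 -> 2 - alpha1 - alpha2 < n%:R / 2 ->
  (\int[mu]_x \int[mu]_y \int[mu]_p prior_weight alpha1 alpha2 K n x y p < +oo)%E.
Proof.
move=> K0 a2 s0 sn; pose s := 2 - alpha1 - alpha2.
pose c x := Num.min (peak x) K.
have c0 x : 0 <= c x by rewrite /c le_min peak_ge0.
pose w x := x `^ (- alpha1) * c x ^+ n.
have w0 x : 0 <= w x by rewrite mulr_ge0 ?powR_ge0// exprn_ge0.
pose q : R := (pi *+ 2) `^ (- 2^-1).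
have q0 : 0 <= q by exact: powR_ge0.
have pw0 x y p : (0 <= prior_weight alpha1 alpha2 K n x y p)%E.
  rewrite /prior_weight; case: ifP => // _.
  by rewrite lee_fin !mulr_ge0 ?powR_ge0// exprn_ge0// c0.
have step1 x y : (\int[mu]_p prior_weight alpha1 alpha2 K n x y p
    <= if ((0 < x) && (x < y))%R then (w x * y `^ (- alpha2))%:E else 0)%E.
  rewrite /prior_weight /in_support; case: ifPn => xy; last first.
    by rewrite integral0.
  apply: (@le_trans _ _ (\int[mu]_(p in `[0%R, 1%R])
      (cst (w x * y `^ (- alpha2))%:E p)))%E; last first.
    by rewrite integral_cst//= lebesgue_measure_itv/= lte_fin ltr01 oppr0 adde0 mule1.
  rewrite [leRHS]integral_mkcond; apply: ge0_le_integralT => p.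
    by case: ifP => // _; rewrite lee_fin !mulr_ge0 ?powR_ge0// exprn_ge0// c0.
  rewrite patchE; case: ifPn => [/= /andP[p0 p1]|_].
    by rewrite mem_set/= ?in_itv/= ?(ltW p0) ?(ltW p1)// lee_fin /w mulrAC.
  by case: ifP => // _; rewrite lee_fin mulr_ge0 ?powR_ge0.
(* The tail integral in [A2] converges because [1 < alpha2]. *)
have step2 x : (\int[mu]_y \int[mu]_p prior_weight alpha1 alpha2 K n x y p
    <= if (0 < x)%R then (w x * (x `^ (1 - alpha2) / (alpha2 - 1)))%:E else 0)%E.
  apply: (@le_trans _ _ (\int[mu]_y
      (if ((0 < x) && (x < y))%R then (w x * y `^ (- alpha2))%:E else 0)))%E.
    by apply: ge0_le_integralT => y//; exact: integral_ge0.
  case: ifPn => x0; last by rewrite integral0.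
  apply: (@le_trans _ _ (\int[mu]_(y in `[x, +oo[) ((w x)%:E * (y `^ (- alpha2))%:E)))%E.
    rewrite [leRHS]integral_mkcond; apply: ge0_le_integralT => y /=.
      by case: ifP => // _; rewrite lee_fin mulr_ge0 ?powR_ge0.
    rewrite patchE; case: ifPn => [xy|_].
      by rewrite mem_set ?EFinM//= in_itv/= ltW.
    by case: ifP => // _; rewrite mule_ge0// lee_fin ?powR_ge0.
  rewrite ge0_integralZl ?lee_fin//.
  - rewrite [leRHS]EFinM; apply: lee_wpmul2l; first by rewrite lee_fin.
    apply: le_trans (integral_powR_tail_le _ x0) _; first by lra.
    by rewrite lee_fin addrC opprB addrC.
  - apply/measurable_EFinP/measurable_funTS; exact: measurable_powR.
  - by move=> y _; rewrite lee_fin powR_ge0.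
(* [g1] comes from [c x <= K] and is integrable near 0 since [0 < s]; [g2] comes from
   [c x <= peak x] and is integrable at infinity since [s < n / 2]. *)
pose k1 := K ^+ n / (alpha2 - 1); pose k2 := q ^+ n / (alpha2 - 1).
have k10 : 0 <= k1 by rewrite divr_ge0 ?exprn_ge0//; lra.
have k20 : 0 <= k2 by rewrite divr_ge0 ?exprn_ge0//; lra.
pose g1 x := (k1%:E * (x `^ (s - 1))%:E)%E.
pose g2 x := (k2%:E * (x `^ (s - 1 - n%:R / 2))%:E)%E.
have mg k e : measurable_fun setT (fun x : measurableTypeR R => (k%:E * (x `^ e)%:E)%E).
  apply: emeasurable_funM => //; apply/measurable_EFinP; exact: measurable_powR.
have g10 x : (0 <= g1 x)%E by rewrite mule_ge0// lee_fin ?powR_ge0.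
have g20 x : (0 <= g2 x)%E by rewrite mule_ge0// lee_fin ?powR_ge0.
have I1 : (\int[mu]_(x in `]0%R, 1%R]) g1 x < +oo)%E.
  rewrite ge0_integralZl ?lee_fin//.
  - apply: lte_mul_pinfty; rewrite ?lee_fin//.
    by apply: le_lt_trans (integral_powR_head_le _ ltr01) (ltry _); rewrite subrK.
  - apply/measurable_EFinP/measurable_funTS; exact: measurable_powR.
  - by move=> y _; rewrite lee_fin powR_ge0.
have I2 : (\int[mu]_(x in `[1%R, +oo[) g2 x < +oo)%E.
  rewrite ge0_integralZl ?lee_fin//.
  - apply: lte_mul_pinfty; rewrite ?lee_fin//.
    apply: le_lt_trans (integral_powR_tail_le _ ltr01) (ltry _); rewrite /s; lra.
  - apply/measurable_EFinP/measurable_funTS; exact: measurable_powR.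
  - by move=> y _; rewrite lee_fin powR_ge0.
apply: (@le_lt_trans _ _ (\int[mu]_x
    ((g1 \_ `]0%R, 1%R]) x + (g2 \_ `[1%R, +oo[) x)))%E; last first.
  rewrite ge0_integralD//.
  - by rewrite -!integral_mkcond lte_add_pinfty.
  - by move=> x _; apply: erestrict_ge0.
  - by apply/(measurable_restrictT g1) => //; apply: measurable_funTS; exact: mg.
  - by move=> x _; apply: erestrict_ge0.
  - by apply/(measurable_restrictT g2) => //; apply: measurable_funTS; exact: mg.
apply: ge0_le_integralT => x.
  by apply: integral_ge0 => y _; exact: integral_ge0.
apply: le_trans (step2 x) _.
have r1 : (0 <= (g1 \_ `]0%R, 1%R]) x)%E by exact: erestrict_ge0.
have r2 : (0 <= (g2 \_ `[1%R, +oo[) x)%E by exact: erestrict_ge0.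
case: ifPn => x0; last exact: adde_ge0.
have E : x `^ (- alpha1) * x `^ (1 - alpha2) = x `^ (s - 1).
  rewrite -powRD; last by apply/implyP => _; rewrite gt_eqF.
  by congr powR; rewrite /s; ring.
have b0 : 0 <= (alpha2 - 1)^-1 by rewrite invr_ge0; lra.
have [x1|x1] := leP x 1.
  apply: (@le_trans _ _ (g1 x)).
    rewrite /g1 -EFinM lee_fin /w /k1 -E.
    have -> : x `^ (- alpha1) * c x ^+ n * (x `^ (1 - alpha2) / (alpha2 - 1)) =
      c x ^+ n / (alpha2 - 1) * (x `^ (- alpha1) * x `^ (1 - alpha2)) by ring.
    rewrite ler_wpM2r ?mulr_ge0 ?powR_ge0// ler_wpM2r//.
    by rewrite lerXn2r ?nnegrE// /c ge_min lexx orbT.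
  by rewrite [X in (_ <= X + _)%E]patchE mem_set ?leeDl//= in_itv/= x0 x1.
apply: (@le_trans _ _ (g2 x)); last first.
  by rewrite [X in (_ <= _ + X)%E]patchE mem_set ?leeDr//= in_itv/= ltW.
rewrite /g2 -EFinM lee_fin /w /k2.
have -> : x `^ (- alpha1) * c x ^+ n * (x `^ (1 - alpha2) / (alpha2 - 1)) =
  c x ^+ n / (alpha2 - 1) * (x `^ (- alpha1) * x `^ (1 - alpha2)) by ring.
rewrite E.
have -> : q ^+ n / (alpha2 - 1) * x `^ (s - 1 - n%:R / 2) =
    peak x ^+ n / (alpha2 - 1) * x `^ (s - 1).
  rewrite peakX// -/q (@powRD _ _ (s - 1)); last by apply/implyP => _; rewrite gt_eqF.
  by ring.
rewrite ler_wpM2r ?powR_ge0// ler_wpM2r//.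
by rewrite lerXn2r ?nnegrE ?peak_ge0// /c ge_min lexx.
Qed.

End prior.

(** * The posterior *)

Section design_rows.
Context (R : realType) (m r : nat) (X : 'M[R]_(m, r)).

(** A row padded with zeros to a function on [nat], the format of [linform]. *)
Definition mxrowfun (i : 'I_m) (j : nat) : R :=
  if insub j is Some k then X i k else 0.

Lemma linform_mxrowfun i b :
  linform r (mxrowfun i) b = (X *m \col_(j < r) b j) i 0.
Proof.
rewrite /linform mxE; apply: eq_bigr => j _; rewrite mxE.
by rewrite /mxrowfun valK.
Qed.

(** Full column rank of [X] is row freeness of its transpose. *)
Lemma injective_mxrowfun : \rank X = r -> injective_rows r mxrowfun.
Proof.
move=> rX b bX j jr.
have /eqP : X *m \col_(j < r) b j = 0.
  by apply/matrixP => i k; rewrite ord1 -linform_mxrowfun bX mxE.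
rewrite -trmx_eq0 trmx_mul mulmx_free_eq0; last by rewrite /row_free mxrank_tr rX.
by rewrite trmx_eq0 => /eqP/matrixP/(_ (Ordinal jr) 0); rewrite !mxE.
Qed.

End design_rows.

(** * The posterior mass for a fixed [delta] *)

Section posterior.
Context (R : realType) (m r : nat) (X : 'M[R]_(m, r)).
Variables (D y : 'I_m -> R) (alpha1 alpha2 : R).
Hypothesis D0 : forall i, 0 < D i.
Variable delta : {ffun 'I_m -> bool}.
Local Notation mu := (@lebesgue_measure R).

Let dens (th b a : nat -> R) : \bar R :=
  post_density X D y alpha1 alpha2 (\col_(i < m) th i) delta
    (\col_(j < r) b j) (a 0%N) (a 1%N) (a 2%N).

Let comp_var (A1 A2 : R) i := if delta i then A2 else A1.

Let comp_prob (p : R) i := if delta i then 1 - p else p.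

Let gauss (mean V x : R) := peak V * expR (- (x - mean) ^+ 2 * (V *+ 2) `^ (-1)).

(** On the support all variances are positive, so [npdf] can be replaced by [gauss], which is
    measurable jointly in all its arguments. *)
Lemma densE th b a : dens th b a =
  if in_support (a 0%N) (a 1%N) (a 2%N) then
    ((\prod_(i < m) (gauss (th i) (D i) (y i)
      * gauss (linform r (mxrowfun X i) b) (comp_var (a 0%N) (a 1%N) i) (th i)
      * comp_prob (a 2%N) i)) * a 0%N `^ (- alpha1) * a 1%N `^ (- alpha2))%:E
  else 0%E.
Proof.
rewrite /dens /post_density /in_support.
case: ifPn => // /andP[/andP[/andP[a0 a01] _] _].
congr (_ * _ * _)%:E; apply: eq_bigr => i _; rewrite !mxE !npdfE//; last first.
  by case: ifP => _ //; exact: lt_trans a01.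
by rewrite linform_mxrowfun mxE.
Qed.

Lemma dens_ge0 th b a : (0 <= dens th b a)%E.
Proof.
rewrite /dens /post_density; case: ifPn => // /andP[/andP[_ p0] p1].
rewrite lee_fin !mulr_ge0 ?powR_ge0// prodr_ge0// => i _.
by rewrite !mulr_ge0 ?normal_pdf_ge0//; case: ifP => _; lra.
Qed.

Lemma dens_gt0 th b a :
  0 < a 0%N -> a 0%N < a 1%N -> 0 < a 2%N -> a 2%N < 1 -> (0 < dens th b a)%E.
Proof.
move=> a0 a01 p0 p1; have a1 : 0 < a 1%N by exact: lt_trans a01.
rewrite /dens /post_density a0 a01 p0 p1 /= lte_fin.
rewrite !mulr_gt0 ?powR_gt0// prodr_gt0// => i _.
by rewrite !mulr_gt0 ?npdf_gt0//; case: ifP => _ //; lra.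
Qed.

Lemma measurable_dens d (S : measurableType d) (th b a : S -> nat -> R) :
  seq_measurable th -> seq_measurable b -> seq_measurable a ->
  measurable_fun setT (fun s => dens (th s) (b s) (a s)).
Proof.
move=> mth mb ma; under eq_fun do rewrite densE.
apply: measurable_fun_ifT => //; first exact: measurable_in_support.
apply/measurable_EFinP; apply: measurable_funM; last exact: measurable_fun_powR.
apply: measurable_funM; last exact: measurable_fun_powR.
apply: measurable_prod => i _; apply: measurable_funM; last first.
  rewrite /comp_prob; case: (delta i) => //; exact: measurable_funB.
apply: measurable_funM; apply: measurable_gauss => //.
  exact: measurable_linform.
by rewrite /comp_var; case: (delta i).
Qed.

Let mass := iint m (fun th => iint r (fun b => iint 3 (fun a => dens th b a))).

Lemma delta_mass_gt0 : (0 < mass)%E.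
Proof.
(* Unit intervals carry positivity: [A1] in []0, 1[], [A2] in []A1, A1 + 1[] and [p] in []0, 1[]
   stay in the support. *)
have mu01 (x : R) : (0 < mu `]x, (x + 1)%R[)%E.
  rewrite lebesgue_measure_itv/= lte_fin ltrDl ltr01 -EFinB lte_fin.
  by rewrite addrAC subrr add0r.
apply: iint_gt0 => [|th].
  apply: vec_measurable_iint => [d S th b mth mb|th b].
    apply: measurable_iint => [|s a]; last exact: dens_ge0.
    move=> d' S' psi a mpsi ma; apply: measurable_dens => // i.
      exact: (measurableT_comp (mth i) mpsi).
    exact: (measurableT_comp (mb i) mpsi).
  by apply: iint_ge0 => a; exact: dens_ge0.
apply: iint_gt0 => [|b].
  apply: vec_measurable_iint => [d S b a mb ma|b a]; last exact: dens_ge0.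
  exact: measurable_dens.
rewrite iintS; apply: (@integral_gt0 _ (measurableTypeR R) R mu _ `]0%R, (0 + 1)%R[%classic).
- apply: measurable_iint => [|x v]; last exact: dens_ge0.
  move=> d S phi a mphi ma; apply: measurable_dens => //.
  exact: seq_measurable_vcons.
- by move=> x; apply: iint_ge0 => v; exact: dens_ge0.
- by [].
- exact: mu01.
move=> x; rewrite /= in_itv/= => /andP[x0 _].
rewrite -/(iint 2 (fun v => dens th b (vcons x v))) iintS.
apply: (@integral_gt0 _ (measurableTypeR R) R mu _ `]x, (x + 1)%R[%classic).
- apply: measurable_iint => [|z v]; last exact: dens_ge0.
  move=> d S phi a mphi ma; apply: measurable_dens => //.
  by apply: seq_measurable_vcons => //; exact: seq_measurable_vcons.
- by move=> z; apply: iint_ge0 => v; exact: dens_ge0.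
- by [].
- exact: mu01.
move=> z; rewrite /= in_itv/= => /andP[xz _].
rewrite -/(iint 1 (fun v => dens th b (vcons x (vcons z v)))) iintS.
apply: (@integral_gt0 _ (measurableTypeR R) R mu _ `]0%R, (0 + 1)%R[%classic).
- apply: measurable_iint => [|p v]; last exact: dens_ge0.
  move=> d S phi a mphi ma; apply: measurable_dens => //.
  apply: seq_measurable_vcons => //; apply: seq_measurable_vcons => //.
  exact: seq_measurable_vcons.
- by move=> p; apply: iint_ge0 => v; exact: dens_ge0.
- by [].
- exact: mu01.
move=> p; rewrite /= in_itv/= add0r => /andP[p0 p1].
exact: dens_gt0.
Qed.

(** Puts [theta] innermost, where its integral factors over the areas, and [A1], [A2], [p]
    outermost, where they are constants for the rest. *)
Lemma delta_massC :
  mass = iint 3 (fun a => iint r (fun b => iint m (fun th => dens th b a))).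
Proof.
rewrite /mass.
transitivity (iint m (fun th => iint 3 (fun a => iint r (fun b => dens th b a)))).
  apply: eq_iint => th; rewrite iint_iintC//; last by move=> *; exact: dens_ge0.
  by move=> d S b a mb ma; exact: measurable_dens.
rewrite iint_iintC; last 2 first.
- move=> d S th a mth ma; apply: measurable_iint => [|s b]; last exact: dens_ge0.
  move=> d' S' phi b mphi mb; apply: measurable_dens => // i.
    exact: (measurableT_comp (mth i) mphi).
  exact: (measurableT_comp (ma i) mphi).
- by move=> th a; apply: iint_ge0 => b; exact: dens_ge0.
apply: eq_iint => a; rewrite iint_iintC//; last by move=> *; exact: dens_ge0.
by move=> d S th b mth mb; exact: measurable_dens.
Qed.

Lemma delta_mass_lty : \rank X = r -> 1 < alpha2 ->
  r%:R + 2 * (2 - alpha1 - alpha2) < m%:R -> 0 < 2 - alpha1 - alpha2 ->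
  (mass < +oo)%E.
Proof.
move=> rX a2 mr s0.
(* This makes [m - r] a true difference when it is turned into a real number below. *)
have rm : (r <= m)%N by rewrite -(ler_nat R); lra.
have [C C0 HC] := iint_linform_bound (injective_mxrowfun rX).
(* The sum bounds all the peaks [peak (D i)] at once. *)
pose K := \sum_(i < m) peak (D i).
have K0 : 0 <= K by rewrite sumr_ge0// => i _; exact: peak_ge0.
have DK i : peak (D i) <= K.
  by rewrite /K (bigD1 i)//= lerDl sumr_ge0// => k _; exact: peak_ge0.
pose pw (a : nat -> R) := prior_weight alpha1 alpha2 K (m - r) (a 0%N) (a 1%N) (a 2%N).
have pw0 a : (0 <= pw a)%E.
  rewrite /pw /prior_weight; case: ifP => // _.
  by rewrite lee_fin !mulr_ge0 ?powR_ge0// exprn_ge0// le_min peak_ge0.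
(* For fixed [a], the integrals over [theta] and [beta] will be bounded by [C] times the prior
   weight. *)
apply: (@le_lt_trans _ _ (iint 3 (fun a => C%:E * pw a)%E)); last first.
  rewrite ge0_iintZl//; last first.
    move=> d S a ma; apply: measurable_fun_ifT => //; first exact: measurable_in_support.
    apply/measurable_EFinP; apply: measurable_funM.
      by apply: measurable_funM; exact: measurable_fun_powR.
    apply: measurable_funX; apply: measurable_minr => //.
    by apply: measurable_fun_powR; exact: measurable_funM.
  apply: lte_mul_pinfty; rewrite ?lee_fin//.
  apply: prior_integral_lty => //.
  by rewrite natrB//; lra.
rewrite delta_massC; apply: le_iint => a.
  by do 2 (apply: iint_ge0 => ?); exact: dens_ge0.
rewrite /pw /prior_weight /in_support; case: ifPn => cond; last first.
  have -> : (fun b => iint m (fun th => dens th b a)) = fun=> 0%E.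
    apply/funext => b; rewrite -[RHS](iint0 R m); apply: eq_iint => th.
    by rewrite /dens /post_density (negbTE cond).
  by rewrite iint0 mule0.
have /andP[/andP[/andP[a0 a01] p0] p1] := cond.
have a1 : 0 < a 1%N by exact: lt_trans a01.
pose V := comp_var (a 0%N) (a 1%N).
have V0 i : 0 < V i by rewrite /V /comp_var; case: ifP.
(* Thanks to [A1 < A2], [peak A1] will bound the peak of either mixture component. *)
have VA i : a 0%N <= V i by rewrite /V /comp_var; case: ifP => // _; exact: ltW.
pose k0 := a 0%N `^ (- alpha1) * a 1%N `^ (- alpha2).
have k00 : 0 <= k0 by rewrite mulr_ge0 ?powR_ge0.
pose f i x := fine (npdf_conv (y i) (D i) (V i) x).
have fE i x : (f i x)%:E = npdf_conv (y i) (D i) (V i) x.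
  by rewrite /f fineK// npdf_conv_fin_num.
pose h b i t := npdf t (D i) (y i) * npdf (linform r (mxrowfun X i) b) (V i) t.
have h0 b i t : 0 <= h b i t by rewrite mulr_ge0// ltW// npdf_gt0.
have mf i : measurable_fun setT (f i).
  apply/measurable_EFinP.
  have -> : EFin \o f i = npdf_conv (y i) (D i) (V i) by apply/funext => x; exact: fE.
  exact: measurable_npdf_conv.
have f0 i x : 0 <= f i x by rewrite fine_ge0// npdf_conv_ge0.
(* The component probabilities are bounded by 1; the [theta]-integral is then a product over the
   areas. *)
have inner b : (iint m (fun th => dens th b a)
    <= k0%:E * (\prod_(i < m) f i (linform r (mxrowfun X i) b))%:E)%E.
  apply: (@le_trans _ _ (iint m (fun th => k0%:E * (\prod_(i < m) h b i (th i))%:E)))%E.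
    apply: le_iint => th; first exact: dens_ge0.
    rewrite /dens /post_density cond -EFinM lee_fin -mulrA -/k0 mulrC.
    rewrite ler_wpM2l//; apply: ler_prod => i _.
    rewrite -linform_mxrowfun !mxE -/(V i) -/(h b i (th i)).
    have p01 : 0 <= (if delta i then 1 - a 2%N else a 2%N) <= 1 by case: ifP => _; lra.
    have /andP[q0 q1] := p01.
    by rewrite mulr_ge0//= -[leRHS]mulr1 ler_wpM2l.
  have mh i : measurable_fun setT (h b i).
    by apply: measurable_funM; exact: measurable_npdf.
  rewrite ge0_iintZl//; last 2 first.
  - move=> d S th mth; apply/measurable_EFinP; apply: measurable_prod => i _.
    exact: (measurableT_comp (mh i) (mth i)).
  - by move=> th; rewrite lee_fin prodr_ge0.
  rewrite iint_prod// => i.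
  have := npdf_conv_fin_num (y i) (D0 i) (V0 i) (linform r (mxrowfun X i) b).
  by rewrite fin_numElt => /andP[].
apply: (@le_trans _ _ (iint r (fun b =>
    k0%:E * (\prod_(i < m) f i (linform r (mxrowfun X i) b))%:E)))%E.
  by apply: le_iint => // b; apply: iint_ge0 => th; exact: dens_ge0.
rewrite ge0_iintZl//; last 2 first.
- move=> d S b mb; apply/measurable_EFinP; apply: measurable_prod => i _.
  by apply: (measurableT_comp (mf i)); exact: measurable_linform.
- by move=> b; rewrite lee_fin prodr_ge0.
rewrite -/k0 [in leRHS]EFinM muleCA; apply: lee_wpmul2l; first by rewrite lee_fin.
(* Here [c] is [min (peak A1) K]: the first bound comes from the component variance, the second from
   the sampling variance. *)
rewrite -EFinM; apply: HC => // [|i x|i].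
- by rewrite le_min peak_ge0.
- rewrite f0 le_min -!lee_fin fE /=; apply/andP; split.
    apply: le_trans (npdf_conv_le_peakV _ (D0 i) (V0 i) _) _.
    by rewrite lee_fin le_peak.
  apply: le_trans (npdf_conv_le_peakD _ (D0 i) (V0 i) _) _.
  by rewrite lee_fin.
- by under eq_integral do rewrite fE; rewrite integral_npdf_conv.
Qed.

End posterior.

Theorem theorem1 (R : realType) (m r : nat) (X : 'M[R]_(m, r))
  (D : 'I_m -> R) (alpha1 alpha2 : R) :
  (1 <= m)%N -> (1 <= r)%N -> \rank X = r ->
  (forall i, 0 < D i) ->
  alpha1 < 1 -> 1 < alpha2 ->
  r%:R + 2 * (2 - alpha1 - alpha2) < m%:R ->
  0 < 2 - alpha1 - alpha2 ->
  forall y : 'I_m -> R,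
    (0 < posterior_mass X D y alpha1 alpha2)%E /\
    (posterior_mass X D y alpha1 alpha2 < +oo)%E.
Proof.
move=> _ _ rX D0 _ a2 mr s0 y; split; last first.
  by apply: lte_sum_pinfty => delta _; exact: delta_mass_lty.
(* All terms are nonnegative, so a single positive one suffices. *)
rewrite /posterior_mass (bigD1 [ffun=> true])//.
apply: lt_le_trans (delta_mass_gt0 X y alpha1 alpha2 D0 [ffun=> true]) _.
rewrite leeDl// sume_ge0// => delta _.
by do 3 (apply: iint_ge0 => ?); exact: dens_ge0.
Qed.
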